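(* There is a universal constant $C>0$ such that for every connected, non-bipartite, triangle-free graph $G=(V,E)$ satisfying $CD(0,\infty)$ we have $$\nu(G)\ge\frac{C}{\mathrm{diam}^2(G)}.$$
   Context: All graphs $G=(V,E)$ are finite and simple; $x\sim y$ denotes adjacency. $E^{or}(G)$ is the set of ordered pairs $(x,y)$ with $x\sim y$. A magnetic potential is a map $\sigma:E^{or}(G)\to S^1=\{z\in\mathbb{C}:|z|=1\}$ with $\sigma(y,x)=\sigma(x,y)^{-1}$. The magnetic Laplacian on functions $f:V\to\mathbb{C}$ is $\Delta^\sigma f(x)=\sum_{y\sim x}(f(x)-\sigma(x,y)f(y))$, and $\lambda_1^\sigma(G)$ is its smallest eigenvalue; $\Delta$ denotes the case $\sigma\equiv1$. The magneto-spectral height is $\nu(G)=\sup_\sigma\lambda_1^\sigma(G)$, over all magnetic potentials. $\mathrm{diam}(G)$ is the diameter in the combinatorial distance. Bakry-\'Emery curvature (trivial potential): for $f,g:V\to\mathbb{C}$, $$2\Gamma(f,g)(x)=\sum_{y\sim x}(f(x)-f(y))\overline{(g(x)-g(y))},$$ $$2\Gamma_2(f,g)(x)=-\Delta\Gamma(f,g)(x)+\Gamma(f,\Delta g)(x)+\Gamma(\Delta f,g)(x).$$ $G$ satisfies $CD(0,\infty)$ if $\Gamma_2(f,f)(x)\ge 0$ for all $x\in V$ and all $f:V\to\mathbb{C}$. *)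

(* Defs.v *)
From HB Require Import structures.
From mathcomp Require Import all_boot all_order all_algebra.
From mathcomp Require Import complex.
From mathcomp Require Import classical_sets reals.

Set Implicit Arguments.
Unset Strict Implicit.
Unset Printing Implicit Defensive.

Import Order.TTheory GRing.Theory Num.Theory.

Local Open Scope ring_scope.

(* A simple graph is a finType V with a symmetric irreflexive e : rel V; both
   properties are hypotheses of the theorem and not used by the definitions. *)

Section Combinatorics.
Variables (V : finType) (e : rel V).

Definition connected_graph : Prop := forall x y : V, connect e x y.

Definition bipartite : Prop :=
  exists c : V -> bool, forall x y : V, e x y -> c x != c y.

Definition triangle_free : Prop :=
  forall x y z : V, ~~ [&& e x y, e y z & e z x].

(* The least length of a path from x to y; a shortest path has fewer than #|V|
   edges, and #|V| is returned when there is no path. *)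
Definition dist (x y : V) : nat :=
  find (fun n => [exists p : n.-tuple V, path e x p && (last x p == y)])
       (iota 0 #|V|).

Definition diam : nat := (\max_(x : V) \max_(y : V) dist x y)%N.

End Combinatorics.

Section Magnetic.
Variables (R : realType) (V : finType) (e : rel V).

(* Only the values of sigma on ordered pairs of adjacent vertices matter:
   the Laplacian below ignores the others. *)
Definition magnetic_potential (sigma : V -> V -> R[i]) : Prop :=
  forall x y : V, e x y ->
    `|sigma x y| = 1 /\ sigma y x = (sigma x y)^-1.

(* ^o makes the functions V -> R[i] a vectType over R[i]. *)
Definition magnetic_laplacian (sigma : V -> V -> R[i])
    (f : {ffun V -> R[i]^o}) : {ffun V -> R[i]^o} :=
  [ffun x => \sum_(y | e x y) (f x - sigma x y * f y)].

Fact magnetic_laplacian_is_linear (sigma : V -> V -> R[i]) :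
  linear (magnetic_laplacian sigma).
Proof.
move=> a f g; apply/ffunP=> x; rewrite !ffunE scaler_sumr -big_split /=.
apply: eq_bigr => y _; rewrite !ffunE /GRing.scale /=.
by rewrite mulrDr mulrBr (mulrCA _ a) opprD addrACA.
Qed.

HB.instance Definition _ (sigma : V -> V -> R[i]) :=
  GRing.isLinear.Build R[i] {ffun V -> R[i]^o} {ffun V -> R[i]^o} _
    (magnetic_laplacian sigma) (magnetic_laplacian_is_linear sigma).

Definition magnetic_eigenvalue (sigma : V -> V -> R[i]) (mu : R[i]) : bool :=
  passmx.leigenvalue (linfun (magnetic_laplacian sigma)) mu.

(* In R[i], z <= w means that w - z is a nonnegative real, so that the second
   clause also says that every eigenvalue is real. *)
Definition is_lambda1 (sigma : V -> V -> R[i]) (l : R) : Prop :=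
  magnetic_eigenvalue sigma l%:C%C /\
  forall mu : R[i], magnetic_eigenvalue sigma mu -> l%:C%C <= mu.

Definition magneto_spectral_height : R :=
  sup [set l : R | exists sigma : V -> V -> R[i],
                     magnetic_potential sigma /\ is_lambda1 sigma l]%classic.

Definition laplacian : {ffun V -> R[i]^o} -> {ffun V -> R[i]^o} :=
  magnetic_laplacian (fun _ _ => 1).

Definition Gamma (f g : {ffun V -> R[i]^o}) : {ffun V -> R[i]^o} :=
  [ffun x => 2%:R^-1 * \sum_(y | e x y) (f x - f y) * ((g x - g y)^*)%C].

Definition Gamma2 (f g : {ffun V -> R[i]^o}) : {ffun V -> R[i]^o} :=
  [ffun x => 2%:R^-1 * (- laplacian (Gamma f g) x + Gamma f (laplacian g) x
                        + Gamma (laplacian f) g x)].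

(* The order on R[i] is the one described at is_lambda1. *)
Definition CD0oo : Prop :=
  forall (f : {ffun V -> R[i]^o}) (x : V), (0 : R[i]) <= Gamma2 f f x.

End Magnetic.

Arguments magneto_spectral_height R {V} e.
Arguments CD0oo R {V} e.

(* Main.v *)
Require Import Defs.
From mathcomp Require Import all_boot all_order all_algebra.
From mathcomp Require Import complex.
From mathcomp Require Import classical_sets reals.
From mathcomp Require Import ring.

(** The potential sigma = -1 already has a large first eigenvalue. Its
    Laplacian, f |-> sum_(y ~ x) (f x + f y), is the signless Laplacian of G:
    on functions that change sign under the deck transformation it is the
    ordinary Laplacian of the bipartite double cover of G. Double cover and
    graph have isomorphic 2-balls because G is triangle-free, so the cover
    inherits CD(0,oo), and it is connected with diameter at most 2 diam G + 1
    because G is connected and not bipartite. On such a graph a gradient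
    estimate bounds the first nonzero eigenvalue below by a constant over the
    squared diameter. The proof runs this argument directly on G.

    Let f be an eigenfunction for the eigenvalue mu, and let
    E x = sum_(y ~ x) |f x + f y|^2, which is twice the carre du champ of the
    lift of f. Applying CD(0,oo) at x to f with its sign flipped on the
    neighbours of x gives a Bochner inequality for E
    ([CD0oo_signless_curvature]). Combined with an exact formula for the
    Laplacian of |f|^2 ([sum_norm_diff]), the maximum principle for
    E + 4 mu |f|^2 gives E <= 8 mu max |f|^2 ([signless_gradient_estimate]).
    So f x + f y is small along every edge: a step along an edge nearly
    changes the sign of f. Going round an odd closed walk of length at most
    2 diam G + 1 through a maximum point x0 of |f| must change f x0 into
    - f x0, which is possible only if mu is not too small
    ([odd_closed_walk_bound], [signless_eigenvalue_lower_bound]).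

    It remains to know that the signless Laplacian has a least eigenvalue,
    because it is a nonnegative operator, and that the supremum defining the
    height is over a bounded set ([magnetic_eigenvalue_le]). *)

Set Implicit Arguments.
Unset Strict Implicit.
Unset Printing Implicit Defensive.

Import Order.TTheory GRing.Theory Num.Theory.
Local Open Scope ring_scope.

(** * Distances and odd cycles *)

Section Distance.
Variables (V : finType) (e : rel V).

(** Removing loops from a walk leaves fewer than #|V| edges, so the search in
    the definition of the distance succeeds. *)
Lemma dist_path (x y : V) : connect e x y ->
  exists p : seq V, [/\ path e x p, last x p = y & size p = dist e x y].
Proof.
move=> /connectP[p0 /shortenP[p ep up _] ->].
rewrite /dist; set P := fun n : nat => [exists q : n.-tuple V, _].
have ltpV : (size p < #|V|)%N by have /card_uniqP /= <- := up; exact: max_card.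
have hasP : has P (iota 0 #|V|).
  apply/hasP; exists (size p); first by rewrite mem_iota.
  by apply/existsP; exists (in_tuple p); rewrite ep eqxx.
have := nth_find 0%N hasP; rewrite nth_iota ?add0n; last first.
  by move: hasP; rewrite has_find size_iota.
by case/existsP=> q /andP[eq /eqP lq]; exists q; rewrite size_tuple.
Qed.

Lemma dist_le_diam (x y : V) : (dist e x y <= diam e)%N.
Proof.
by rewrite /diam (bigD1 x)//= leq_max (bigD1 y)//= leq_max leqnn.
Qed.

(** Used with the parity of the distance to a base point: the edge found
    closes up an odd walk through that point. *)
Lemma not_bipartite_even_edge (c : V -> bool) : ~ bipartite e ->
  exists x y, e x y /\ c x = c y.
Proof.
move=> nb; case: (boolP [exists x, exists y, e x y && (c x == c y)]).
  by move=> /existsP[x /existsP[y /andP[exy /eqP cxy]]]; exists x, y.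
move=> nex; case: nb; exists c => x y exy; apply: contra nex => cxy.
by apply/existsP; exists x; apply/existsP; exists y; rewrite exy.
Qed.

End Distance.

(** * Eigenfunctions of the signless Laplacian *)

Section SignlessLaplacian.
Variables (C : numClosedFieldType) (V : finType) (e : rel V).
Hypothesis esym : symmetric e.

(** Twice the carre du champ of the lift of f to the double cover. *)
Definition signless_energy (f : V -> C) (x : V) : C :=
  \sum_(y | e x y) `|f x + f y| ^+ 2.

Definition signless_eigen (mu : C) (f : V -> C) : Prop :=
  forall x, \sum_(y | e x y) (f x + f y) = mu * f x.

Lemma signless_energy_ge0 f x : 0 <= signless_energy f x.
Proof. by apply: sumr_ge0 => y _; rewrite exprn_ge0. Qed.

(** Green's formula: the quadratic form of the signless Laplacian is half the
    total energy. *)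
Lemma sum_signless_energy mu f : signless_eigen mu f ->
  \sum_x signless_energy f x = 2 * mu * \sum_x `|f x| ^+ 2.
Proof.
move=> ef.
have half : \sum_x \sum_(y | e x y) (f x)^* * (f x + f y) =
            mu * \sum_x `|f x| ^+ 2.
  rewrite mulr_sumr; apply: eq_bigr => x _.
  by rewrite -mulr_sumr ef normCK; ring.
have half' : \sum_x \sum_(y | e x y) (f y)^* * (f x + f y) =
            mu * \sum_x `|f x| ^+ 2.
  rewrite -half (exchange_big_dep predT)//=; apply: eq_bigr => y _.
  rewrite (eq_bigl (e y)); last by move=> x; rewrite esym.
  by apply: eq_bigr => x _; rewrite addrC.
rewrite -mulrA mulrDl mul1r -{1}half -half' -big_split/=.
apply: eq_bigr => x _; rewrite -big_split/=; apply: eq_bigr => y _.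
by rewrite normCK rmorphD; ring.
Qed.

Lemma signless_eigenvalue_ge0 mu f x0 :
  signless_eigen mu f -> f x0 != 0 -> 0 <= mu.
Proof.
move=> /sum_signless_energy ef fx0.
have N_gt0 : 0 < 2 * \sum_x `|f x| ^+ 2.
  rewrite mulr_gt0// (bigD1 x0)//= ltr_wpDr ?exprn_gt0 ?normr_gt0//.
  by apply: sumr_ge0 => y _; rewrite exprn_ge0.
rewrite -(pmulr_lge0 _ N_gt0) mulrCA mulrA -ef.
by apply: sumr_ge0 => x _; exact: signless_energy_ge0.
Qed.

(** The analogue of Delta (f^2) = 2 f Delta f - 2 Gamma f. *)
Lemma sum_norm_diff mu f x : mu \is Num.real -> signless_eigen mu f ->
  \sum_(y | e x y) (`|f y| ^+ 2 - `|f x| ^+ 2) =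
  signless_energy f x - 2 * mu * `|f x| ^+ 2.
Proof.
move=> mur ef.
have h1 : \sum_(y | e x y) (f x)^* * (f x + f y) = mu * `|f x| ^+ 2.
  by rewrite -mulr_sumr ef normCK; ring.
have h2 : \sum_(y | e x y) f x * (f x + f y)^* = mu * `|f x| ^+ 2.
  by rewrite -mulr_sumr -rmorph_sum ef rmorphM/= (CrealP mur) normCK; ring.
rewrite -mulrA mulrDl mul1r -{1}h1 -h2 -big_split -sumrB/=.
by apply: eq_bigr => y _; rewrite !normCK !rmorphD; ring.
Qed.

(** What Gamma2 >= 0 becomes for the lift of an eigenfunction f to the double
    cover: there the terms Gamma (f, Delta f) reduce to mu Gamma (f, f). *)
Definition signless_curvature (mu : C) (f : V -> C) : Prop := forall x,
  0 <= \sum_(y | e x y) (signless_energy f y - signless_energy f x)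
       + 2 * mu * signless_energy f x.

(** Maximum principle. At a maximum of E + a |f|^2 its differences sum to
    at most 0, while the Bochner inequality and [sum_norm_diff] bound that sum
    below by (a - 2 mu) E - 2 a mu |f|^2; any a > 2 mu then controls E
    by |f|^2 at this point, and a = 4 mu gives E <= 4 mu |f|^2. *)
Lemma signless_gradient_estimate mu f x0 :
  0 <= mu -> signless_eigen mu f -> signless_curvature mu f ->
  (forall x, `|f x| <= `|f x0|) ->
  forall x, signless_energy f x <= 8 * mu * `|f x0| ^+ 2.
Proof.
move=> mu0 ef cf fmax x.
have mur := ger0_real mu0.
have fmax2 y : `|f y| ^+ 2 <= `|f x0| ^+ 2 by rewrite lerXn2r ?nnegrE.
have En := signless_energy_ge0 f.
have sumE := sum_signless_energy ef.
(* The maximum principle says nothing for mu = 0, but then E vanishes. *)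
have [mu_eq0|mu_neq0] := eqVneq mu 0.
  have -> : signless_energy f x = 0.
    by apply: (psumr_eq0P _ (_ : \sum_y signless_energy f y = 0)) => //;
       rewrite sumE mu_eq0 mulr0 mul0r.
  by rewrite !mulr_ge0.
have mu_gt0 : 0 < mu by rewrite lt0r mu_neq0.
pose F y := signless_energy f y + 4 * mu * `|f y| ^+ 2.
have Fr : {in predT, forall y, F y \is Num.real}.
  by move=> y _; rewrite ger0_real// addr_ge0// !mulr_ge0.
case: (real_arg_maxP (erefl : predT x0) Fr) => z _ Fmax.
have Ez : signless_energy f z <= 4 * mu * `|f z| ^+ 2.
  have : \sum_(y | e z y) (F y - F z) <= 0.
    by apply: sumr_le0 => y _; rewrite subr_le0; exact: Fmax.
  rewrite /F; under eq_bigr => y _ do rewrite opprD addrACA -mulrBr.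
  rewrite big_split/= -mulr_sumr (sum_norm_diff z mur ef) => sum_le0.
  have mu2_gt0 : 0 < 2 * mu by rewrite mulr_gt0.
  rewrite -(ler_pM2l mu2_gt0) -subr_ge0.
  rewrite -oppr_ge0 in sum_le0; apply: le_trans (addr_ge0 sum_le0 (cf z)) _.
  by rewrite le_eqVlt; apply/orP; left; apply/eqP; ring.
have Fx : F x <= F z by exact: Fmax.
apply: (@le_trans _ _ (F x)); first by rewrite lerDl !mulr_ge0.
apply: (le_trans Fx).
apply: (@le_trans _ _ (8 * mu * `|f z| ^+ 2)); last first.
  by rewrite ler_wpM2l// mulr_ge0.
have -> : 8 * mu * `|f z| ^+ 2 =
          4 * mu * `|f z| ^+ 2 + 4 * mu * `|f z| ^+ 2 by ring.
by rewrite lerD2r.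
Qed.

Lemma signless_walk_bound (f : V -> C) (s : C) x0 p :
  (forall x y, e x y -> `|f x + f y| <= s) -> path e x0 p ->
  `|f (last x0 p) - (-1) ^+ size p * f x0| <= (size p)%:R * s.
Proof.
move=> fs; elim/last_ind: p => [|p y IH].
  by rewrite /= expr0 mul1r subrr normr0 mul0r.
rewrite rcons_path last_rcons size_rcons => /andP[/IH {}IH exy].
have -> : f y - (-1) ^+ (size p).+1 * f x0 =
  (f (last x0 p) + f y) - (f (last x0 p) - (-1) ^+ size p * f x0).
  by rewrite exprS; ring.
apply: (le_trans (ler_normB _ _)).
by rewrite -add1n natrD mulrDl mul1r lerD// fs.
Qed.

(** Walks from x0 to both ends of an edge u v, of lengths of the same parity,
    form with this edge an odd closed walk of length at most 2 D + 1. Along it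
    f would alternate in sign if s were 0, forcing f x0 = - f x0. *)
Lemma odd_closed_walk_bound (f : V -> C) (s : C) x0 D :
  connected_graph e -> ~ bipartite e -> (forall y, (dist e x0 y <= D)%N) ->
  (forall x y, e x y -> `|f x + f y| <= s) ->
  2 * `|f x0| <= (2 * D + 1)%N%:R * s.
Proof.
move=> conn nb distD fs.
have [u [v [euv duv]]] := not_bipartite_even_edge (fun y => odd (dist e x0 y)) nb.
have s0 : 0 <= s by exact: le_trans (fs _ _ euv).
have near y : `|f y - (-1) ^+ odd (dist e x0 y) * f x0| <= D%:R * s.
  have [p [ep lp sp]] := dist_path (conn x0 y).
  have := signless_walk_bound fs ep; rewrite lp sp signr_odd => /le_trans; apply.
  by rewrite ler_wpM2r// ler_nat.
have nu := near u; have nv := near v; rewrite -duv in nv.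
set a := (-1) ^+ _ in nu nv.
(* The error terms of the two walks and of the edge u v add up to 2 f x0. *)
have -> : 2 * `|f x0| = `|(f u + f v) - (f u - a * f x0) - (f v - a * f x0)|.
  have -> : (f u + f v) - (f u - a * f x0) - (f v - a * f x0) =
            a * (2 * f x0) by ring.
  by rewrite normrM normr_sign mul1r normrM normr_nat.
apply: (le_trans (ler_normB _ _)); rewrite natrD natrM.
have -> : (2 * D%:R + 1) * s = s + D%:R * s + D%:R * s by ring.
by rewrite lerD// (le_trans (ler_normB _ _))// lerD// fs.
Qed.

Lemma signless_eigenvalue_lower_bound mu f D :
  connected_graph e -> ~ bipartite e -> (forall x y, (dist e x y <= D)%N) ->
  0 <= mu -> signless_eigen mu f -> signless_curvature mu f ->
  (exists x, f x != 0) ->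
  1 <= 2 * (2 * D + 1)%N%:R ^+ 2 * mu.
Proof.
move=> conn nb distD mu0 ef cf [x1 fx1].
have fr : {in predT, forall y, `|f y| \is Num.real}.
  by move=> y _; exact: normr_real.
case: (real_arg_maxP (erefl : predT x1) fr) => x0 _ fmax.
have M_gt0 : 0 < `|f x0| ^+ 2.
  by rewrite exprn_gt0// (lt_le_trans _ (fmax x1 _))// normr_gt0.
have grad :=
  signless_gradient_estimate mu0 ef cf (fun x => fmax x (erefl : predT x)).
have s2_ge0 : 0 <= 8 * mu * `|f x0| ^+ 2 by rewrite !mulr_ge0.
pose s := sqrtC (8 * mu * `|f x0| ^+ 2).
have sK : s ^+ 2 = 8 * mu * `|f x0| ^+ 2 by exact: sqrtCK.
have s0 : 0 <= s by rewrite sqrtC_ge0.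
have fs x y : e x y -> `|f x + f y| <= s.
  move=> exy; rewrite -(@ler_pXn2r _ 2)// ?nnegrE// sK.
  apply: le_trans (grad x); rewrite /signless_energy (bigD1 y)//= lerDl.
  by apply: sumr_ge0 => z _; rewrite exprn_ge0.
have le4 := odd_closed_walk_bound conn nb (distD x0) fs.
rewrite -(@ler_pXn2r _ 2) ?nnegrE ?mulr_ge0// !exprMn sK in le4.
have M4_gt0 : 0 < 4 * `|f x0| ^+ 2 by rewrite mulr_gt0.
rewrite -(ler_pM2r M4_gt0) mul1r.
have -> : 4 * `|f x0| ^+ 2 = 2 ^+ 2 * `|f x0| ^+ 2 by ring.
apply: le_trans le4 _.
by rewrite le_eqVlt; apply/orP; left; apply/eqP; ring.
Qed.

End SignlessLaplacian.

(** * Curvature *)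

Section Curvature.
Variables (R : realType) (V : finType) (e : rel V).
Hypotheses (esym : symmetric e) (eirr : irreflexive e).
Hypothesis tf : triangle_free e.

(** Gamma2 at x only sees the 2-ball around x. Flipping the sign of f on the
    neighbours of x turns differences along edges of this ball into sums,
    provided that no edge joins two neighbours of x, that is, that x lies in
    no triangle. *)
Lemma CD0oo_signless_curvature mu (f : V -> R[i]) : mu \is Num.real ->
  CD0oo R e -> signless_eigen e mu f -> signless_curvature e mu f.
Proof.
move=> mur cd ef x.
pose h : {ffun V -> R[i]^o} := [ffun v => if e x v then - f v else f v].
have hx : h x = f x by rewrite ffunE eirr.
have hx1 y : e x y -> h y = - f y by move=> exy; rewrite ffunE exy.
have hx2 y z : e x y -> e y z -> h z = f z.
  move=> exy eyz; rewrite ffunE.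
  by have := tf x y z; rewrite exy eyz/= esym => /negbTE ->.
have Gx : Gamma e h h x = 2^-1 * signless_energy e f x.
  rewrite ffunE; congr (_ * _); apply: eq_bigr => y exy.
  by rewrite hx (hx1 y)// opprK normCK.
have Gy y : e x y -> Gamma e h h y = 2^-1 * signless_energy e f y.
  move=> exy; rewrite ffunE; congr (_ * _); apply: eq_bigr => z eyz.
  by rewrite (hx1 y)// (hx2 y z)// -opprD -normrN normCK.
have Lx : laplacian e h x = mu * f x.
  rewrite ffunE -ef; apply: eq_bigr => y exy.
  by rewrite hx (hx1 y)// mul1r opprK.
have Ly y : e x y -> laplacian e h y = - (mu * f y).
  move=> exy; rewrite ffunE -ef -sumrN; apply: eq_bigr => z eyz.
  by rewrite (hx1 y)// (hx2 y z)// mul1r opprD.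
have GL : Gamma e h (laplacian e h) x = 2^-1 * (mu * signless_energy e f x).
  rewrite ffunE; congr (_ * _); rewrite mulr_sumr; apply: eq_bigr => y exy.
  rewrite hx (hx1 y)// Lx (Ly y)// !opprK -mulrDr normCK.
  have -> : ((mu * (f x + f y))^*)%C = mu * (f x + f y)^*.
    exact: etrans (rmorphM Num.conj_op _ _) (congr1 ( *%R^~ _) (CrealP mur)).
  by rewrite mulrCA.
have LG : Gamma e (laplacian e h) h x = 2^-1 * (mu * signless_energy e f x).
  rewrite ffunE; congr (_ * _); rewrite mulr_sumr; apply: eq_bigr => y exy.
  by rewrite hx (hx1 y)// Lx (Ly y)// !opprK -mulrDr normCK mulrA.
have LGx : laplacian e (Gamma e h h) x = 2^-1 *
    \sum_(y | e x y) (signless_energy e f x - signless_energy e f y).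
  rewrite [LHS]ffunE mulr_sumr; apply: eq_bigr => y exy.
  by rewrite mul1r Gx (Gy y)// mulrBr.
have := cd h x; rewrite ffunE GL LG LGx.
have -> : \sum_(y | e x y) (signless_energy e f x - signless_energy e f y) =
  - \sum_(y | e x y) (signless_energy e f y - signless_energy e f x).
  by rewrite -sumrN; apply: eq_bigr => y _; rewrite opprB.
(* The Bochner expression is 4 times Gamma2 (h, h) x. *)
have c4 : (0 : R[i]) < 4^-1 by rewrite invr_gt0.
rewrite -[X in _ -> is_true X](pmulr_rge0 _ c4) => /le_trans; apply.
by rewrite le_eqVlt; apply/orP; left; apply/eqP; field.
Qed.

End Curvature.

(** * Magnetic eigenvalues and the height *)

Lemma leigenvalueP (F : fieldType) (vT : vectType F) (phi : 'End(vT)) (a : F) :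
  reflect (exists2 u, phi u = a *: u & u != 0) (passmx.leigenvalue phi a).
Proof.
apply: (iffP idP) => [|[u pu u0]]; rewrite /passmx.leigenvalue.
  rewrite -vpick0 => u0; exists (vpick (passmx.leigenspace phi a)) => //.
  have := memv_pick (passmx.leigenspace phi a).
  by rewrite memv_ker !lfun_simp subr_eq0 => /eqP.
apply: contraNneq u0 => E0; rewrite -memv0 -E0 memv_ker.
by rewrite !lfun_simp pu subrr.
Qed.

(** The order of C is partial, so a least eigenvalue needs a spectrum of
    comparable elements; being the root set of the characteristic polynomial,
    it is finite and not empty. *)
Lemma exists_least_leigenvalue (C : numClosedFieldType) (vT : vectType C)
    (phi : 'End(vT)) (u : vT) : u != 0 ->
  (forall a, passmx.leigenvalue phi a -> a \is Num.real) ->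
  exists a, passmx.leigenvalue phi a /\
            forall b, passmx.leigenvalue phi b -> a <= b.
Proof.
move=> u0 phir.
have dim_gt0 : (0 < \dim {:vT})%N.
  rewrite lt0n dimv_eq0; apply: contraNneq u0 => E0.
  by rewrite -memv0 -E0 memvf.
pose bas := vbasis {:vT}; have basP : basis_of {:vT} bas := vbasisP _.
pose A := passmx.mxof bas bas phi.
have eigA a : passmx.leigenvalue phi a = eigenvalue A a.
  by rewrite /passmx.leigenvalue (passmx.leigenspaceE basP) passmx.vsof_eq0.
have [rs charE] := closed_field_poly_normal (char_poly A).
have eigrs a : passmx.leigenvalue phi a = (a \in rs).
  rewrite eigA eigenvalue_root_char charE rootZ ?root_prod_XsubC//.
  by rewrite lead_coef_eq0 monic_neq0 ?char_poly_monic.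
have [a0 a0P] := eigenvalue_closed A dim_gt0.
have a0rs : a0 \in rs by rewrite -eigrs eigA.
pose i0 := Ordinal (etrans (index_mem a0 rs) a0rs).
have rsr : {in predT, forall i : 'I_(size rs), rs`_i \is Num.real}.
  by move=> i _; apply: phir; rewrite eigrs mem_nth.
case: (real_arg_minP (erefl : predT i0) rsr) => i _ imin.
exists rs`_i; split; first by rewrite eigrs mem_nth.
move=> b; rewrite eigrs => brs.
have := imin (Ordinal (etrans (index_mem b rs) brs)) isT.
by rewrite /= nth_index.
Qed.

Section Eigenvalues.
Variables (R : realType) (V : finType) (e : rel V).

Lemma magnetic_eigenvalueP (sigma : V -> V -> R[i]) mu :
  reflect (exists f : {ffun V -> R[i]^o},
     (forall x, \sum_(y | e x y) (f x - sigma x y * f y) = mu * f x)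
     /\ exists x, f x != 0)
    (magnetic_eigenvalue e sigma mu).
Proof.
apply: (iffP (leigenvalueP _ _)) => [[f]|[f [ef [x fx]]]].
  rewrite lfunE/= => ef f0; exists f; split.
    move=> x.
    by have := congr1 (fun g : {ffun V -> R[i]^o} => g x) ef; rewrite !ffunE.
  apply/existsP; apply: contraNT f0 => /existsPn f0; apply/eqP/ffunP => x.
  by rewrite ffunE; apply/eqP; have := f0 x; rewrite negbK.
exists f; first by rewrite lfunE; apply/ffunP => y; rewrite !ffunE.
by apply: contraNneq fx => ->; rewrite ffunE.
Qed.

(** Each row of the matrix of the Laplacian has entries of total modulus twice
    a degree; this is read off at a maximum point of |f|. *)
Lemma magnetic_eigenvalue_le (sigma : V -> V -> R[i]) mu :
  magnetic_potential e sigma -> magnetic_eigenvalue e sigma mu ->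
  `|mu| <= (2 * #|V|)%:R.
Proof.
move=> msigma /magnetic_eigenvalueP[f [ef [x1 fx1]]].
have fr : {in predT, forall y, `|f y| \is Num.real}.
  by move=> y _; exact: normr_real.
case: (real_arg_maxP (erefl : predT x1) fr) => x _ fmax.
have fx_gt0 : 0 < `|f x|.
  by rewrite (lt_le_trans _ (fmax x1 _))// normr_gt0.
rewrite -(ler_pM2r fx_gt0) -normrM -ef.
apply: (le_trans (ler_norm_sum _ _ _)).
apply: (@le_trans _ _ (\sum_(y | e x y) 2 * `|f x|)).
  apply: ler_sum => y exy; apply: (le_trans (ler_normB _ _)).
  by rewrite normrM (msigma x y exy).1 mul1r mulrDl mul1r lerD2l; exact: fmax.
rewrite sumr_const -[X in X <= _]mulr_natl mulrA -natrM ler_pM2r// ler_nat mulnC.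
by rewrite leq_mul2l max_card orbT.
Qed.

Lemma lambda1_le_height (sigma : V -> V -> R[i]) l :
  magnetic_potential e sigma -> is_lambda1 e sigma l ->
  l <= magneto_spectral_height R e.
Proof.
move=> msigma lsigma; apply: ub_le_sup; last by exists sigma.
exists (2 * #|V|)%:R => k [tau [mtau [ktau _]]].
have k_le := le_trans (normc_ge_Re _) (magnetic_eigenvalue_le mtau ktau).
rewrite -(rmorph_nat (real_complex R)) lecR in k_le.
exact: le_trans (ler_norm k) k_le.
Qed.

End Eigenvalues.

Theorem proposition3p13 (R : realType) :
  exists C : R, 0 < C /\
    forall (V : finType) (e : rel V),
      symmetric e -> irreflexive e ->
      connected_graph e -> ~ bipartite e -> triangle_free e ->
      CD0oo R e ->
      C / (diam e)%:R ^+ 2 <= magneto_spectral_height R e.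
Proof.
(* 18 = 2 * 3 ^ 2, from 2 D + 1 <= 3 D in the bound 1 <= 2 (2 D + 1)^2 mu. *)
exists 18^-1; split; first by rewrite invr_gt0.
move=> V e esym eirr conn nb tf cd.
pose sigma : V -> V -> R[i] := fun _ _ => -1.
have msigma : magnetic_potential e sigma.
  by move=> x y _; rewrite /sigma normrN1 invrN1.
have eigenP mu : magnetic_eigenvalue e sigma mu ->
    exists f : {ffun V -> R[i]^o}, signless_eigen e mu f /\ exists x, f x != 0.
  move=> /magnetic_eigenvalueP[f [ef f0]]; exists f; split=> // x.
  by rewrite -ef; apply: eq_bigr => y _; rewrite mulN1r opprK.
have eigen_ge0 mu : magnetic_eigenvalue e sigma mu -> 0 <= mu.
  by move=> /eigenP[f [ef [x fx]]]; exact: signless_eigenvalue_ge0 esym _ _ _ ef fx.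
(* The empty graph is bipartite. *)
have [x0 _] := not_bipartite_even_edge (fun=> true) nb.
have one_neq0 : [ffun=> 1] != 0 :> {ffun V -> R[i]^o}.
  by apply/eqP => /ffunP/(_ x0); rewrite !ffunE; apply/eqP/oner_neq0.
have [mu [mueig mumin]] :=
  exists_least_leigenvalue one_neq0 (fun a ea => ger0_real (eigen_ge0 a ea)).
have mu_ge0 := eigen_ge0 _ mueig.
have muE : mu = (complex.Re mu)%:C%C by rewrite RRe_real// ger0_real.
have l_ge0 : 0 <= complex.Re mu by move: mu_ge0; rewrite muE -(lecR 0).
have lam : is_lambda1 e sigma (complex.Re mu) by rewrite /is_lambda1 -muE.
apply: le_trans (lambda1_le_height msigma lam).
have [f [ef f0]] := eigenP _ mueig.
have curv := CD0oo_signless_curvature esym eirr tf (ger0_real mu_ge0) cd ef.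
set l := complex.Re mu; set D := diam e.
have bound : 1 <= 2 * (2 * D + 1)%:R ^+ 2 * l.
  have := signless_eigenvalue_lower_bound esym conn nb (dist_le_diam e)
    mu_ge0 ef curv f0.
  by rewrite [X in _ * X]muE -lecR !rmorphM /= !rmorph_nat -expr2.
have [D0|D_gt0] := posnP D; first by rewrite D0 expr0n invr0 mulr0.
have D2_gt0 : 0 < D%:R ^+ 2 :> R by rewrite exprn_gt0// ltr0n.
have le3 : (2 * D + 1)%:R ^+ 2 <= (3 * D)%:R ^+ 2 :> R.
  rewrite lerXn2r ?nnegrE// ler_nat -[leqRHS]/((2 + 1) * D)%N mulnDl.
  by rewrite leq_add2l mul1n.
rewrite ler_pdivrMr// -(@ler_pM2l _ 18)// mulfV ?pnatr_eq0//.
apply: le_trans bound _.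
have -> : 18 * (l * D%:R ^+ 2) = 2 * (3 * D)%:R ^+ 2 * l by ring.
by rewrite ler_wpM2r// ler_wpM2l.
Qed.
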